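(* Let $D$ be an integral domain with finite character on maximal ideals (i.e., each nonzero element of $D$ belongs to only finitely many maximal ideals). The following are equivalent. (i) $D$ is $b$-Noetherian. (ii) $D_P$ is $b_P$-Noetherian for each prime ideal $P$ of $D$. (iii) $D_M$ is $b_M$-Noetherian for each maximal ideal $M$ of $D$.
   Context: Let $R$ be an integral domain with quotient field $K$. An overring of $R$ is a ring $T$ with $R\subseteq T\subseteq K$; a valuation overring is an overring which is a valuation domain. The $b$-operation of $R$ is defined, for each nonzero $R$-submodule $E$ of $K$, by $E^{b}:=\bigcap\{EV \mid V \text{ valuation overring of } R\}$. $R$ is Noetherian with respect to its $b$-operation ($b$-Noetherian) if the ascending chain condition holds on quasi-$b$-ideals of $R$, i.e. nonzero ideals $I$ of $R$ with $I^b\cap R=I$; equivalently, for each nonzero ideal $I$ of $R$ there is a finitely generated ideal $F\subseteq I$ with $F^b=I^b$. For a prime $P$ of $D$, $b_P$ denotes the $b$-operation of $D_P$. *)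

(* Defs.v *)
From HB Require Import structures.
From mathcomp Require Import all_boot all_order all_algebra.
From mathcomp Require Import all_classical.
From mathcomp Require Export ring_quotient fraction.

Set Implicit Arguments.
Unset Strict Implicit.
Unset Printing Implicit Defensive.

Import GRing.Theory.
Local Open Scope classical_set_scope.
Local Open Scope ring_scope.

Section BOperation.
Variable K : fieldType.

(* Throughout, [R] is meant to be a subring of [K] whose quotient field is [K],
   so that the overrings of [R] are the subrings of [K] containing [R]. *)
Implicit Types R T V E I : set K.

Definition overring R T := GRing.subring_closed (mem T) /\ R `<=` T.

(* The quotient field of an overring of [R] is [K], hence the condition ranges
   over all nonzero elements of [K]. *)
Definition valuation_overring R V :=
  overring R V /\ forall x, x != 0 -> V x \/ V x^-1.

Definition submodule R E :=
  E 0 /\ forall a x y, R a -> E x -> E y -> E (a * x + y).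

Definition nonzero_set E := exists2 x, E x & x != 0.

(* The module product [EV]: finite sums of products [e * v]. *)
Definition prodmod E V : set K :=
  [set x | exists s : seq (K * K),
     (forall p, p \in s -> E p.1 /\ V p.2) /\ x = \sum_(p <- s) p.1 * p.2].

(* Only meaningful when [E] is a nonzero [R]-submodule of [K]. *)
Definition b_op R E : set K :=
  \bigcap_(V in valuation_overring R) prodmod E V.

Definition quasi_b_ideal R I :=
  [/\ submodule R I, I `<=` R, nonzero_set I & b_op R I `&` R = I].

Definition b_noetherian R :=
  forall I : nat -> set K,
    (forall n, quasi_b_ideal R (I n)) ->
    (forall n, I n `<=` I n.+1) ->
    exists N, forall n, (N <= n)%N -> I n = I N.

End BOperation.

Section Domain.
Variable D : idomainType.

(* Boolean predicates on [D] are arbitrary subsets in the presence of the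
   classical axioms; [idealr_closed] includes properness. The zero ideal is
   prime, with localization the whole field. *)
Definition prime_ideal (P : {pred D}) :=
  idealr_closed P /\ prime_idealr_closed P.

Definition maximal_ideal (M : {pred D}) :=
  idealr_closed M /\
  forall J : {pred D}, idealr_closed J -> {subset M <= J} -> {subset J <= M}.

Definition finite_character_max :=
  forall x : D, x != 0 ->
    finite_set [set M : {pred D} | maximal_ideal M /\ x \in M].

Definition dom_in_frac : set {fraction D} := range (@tofrac D).

Definition localization (P : {pred D}) : set {fraction D} :=
  [set x | exists a s : D, s \notin P /\ x = tofrac a / tofrac s].

End Domain.

Arguments finite_character_max : clear implicits.
Arguments dom_in_frac : clear implicits.

(* Main.v *)
Require Import Defs.
From mathcomp Require Import all_boot all_order all_algebra.
From mathcomp Require Import all_classical.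

(** Why the theorem is true.

    Going down to a localization is formal.  If each element of an overring
    [S] of [R] has a denominator in [R] that is invertible in [S], then a
    quasi-b-ideal [I] of [S] is determined by [I] /\ [R], which is a
    quasi-b-ideal of [R] because the valuation overrings of [S] are among those
    of [R].  So ascending chains in [S] stabilize when those in [R] do
    ([b_noetherian_localization]).  This applies to [D_P] over [D], and to
    [D_P] over [D_M] for a maximal ideal [M] containing [P].

    Coming back up to [D] rests on two facts.  Each valuation overring [V] of
    [D] contains some [D_M]: the elements of [D] that are not units of [V] form
    a proper ideal, and any maximal ideal [M] above it will do
    ([valuation_overring_contains_localization]).  Hence the b-operation of [D]
    is the intersection of those of the rings [D_M].  Now fix a chain [I_n] of
    quasi-b-ideals of [D] and a nonzero [x] in [I_0].  In each of the finitely
    many [D_M] with [x] in [M], the closures of the [I_n] form a chain of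
    quasi-b-ideals, which stabilizes; in every other [D_M] the element [x] is a
    unit, so the closures all equal [D_M].  Therefore one index serves all the
    rings [D_M] at once, and from it on the chain [I_n] is constant
    ([b_noetherian_finite_character]). *)

Set Implicit Arguments.
Unset Strict Implicit.
Unset Printing Implicit Defensive.

Import GRing.Theory.
Local Open Scope classical_set_scope.
Local Open Scope ring_scope.

(** * Products of submodules and the b-operation *)

Section BOperationTheory.
Variable K : fieldType.
Implicit Types R S T V E F I : set K.

Lemma overring1 R V : overring R V -> V 1.
Proof. by case=> -[]; rewrite inE. Qed.

Lemma overring_submodule R V : overring R V -> submodule V V.
Proof.
case=> -[V1 VB VM] _.
have V0 : 0 \in mem V by rewrite -(subrr 1) VB.
split=> [|a x y Va Vx Vy]; first by rewrite inE in V0.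
apply: set_mem; rewrite -[y]opprK -[- y]sub0r.
by apply: (VB); [apply: VM; apply: mem_set|apply: VB V0 (mem_set Vy)].
Qed.

Lemma submoduleM R E a x : submodule R E -> R a -> E x -> E (a * x).
Proof. by case=> E0 Elin Ra Ex; rewrite -[a * x]addr0; apply: Elin. Qed.

Lemma submodule_subring R S E : R `<=` S -> submodule S E -> submodule R E.
Proof. by move=> RS [E0 Elin]; split=> // a x y /RS; apply: Elin. Qed.

Lemma submoduleI R E F :
  submodule R E -> submodule R F -> submodule R (E `&` F).
Proof.
move=> [E0 Elin] [F0 Flin]; split=> // a x y Ra [Ex Fx] [Ey Fy].
by split; [apply: Elin|apply: Flin].
Qed.

Lemma sub_prodmod E V : V 1 -> E `<=` prodmod E V.
Proof.
move=> V1 x Ex; exists [:: (x, 1)]; split; last by rewrite big_seq1 mulr1.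
by move=> p; rewrite inE => /eqP ->.
Qed.

Lemma prodmod_submodule E V : submodule V V -> submodule V (prodmod E V).
Proof.
move=> Vm; split; first by exists [::]; rewrite big_nil.
move=> a _ _ Va [s [sEV ->]] [t [tEV ->]].
exists ([seq (p.1, a * p.2) | p <- s] ++ t); split.
  move=> p; rewrite mem_cat => /orP[/mapP[q /sEV[Eq Vq] ->]|/tEV//].
  by split=> //; apply: submoduleM Vm _ _.
rewrite big_cat big_map mulr_sumr; congr (_ + _).
by apply: eq_bigr => p _; rewrite mulrCA.
Qed.

Lemma prodmod_min E F V : submodule V F -> E `<=` F -> prodmod E V `<=` F.
Proof.
move=> [F0 Flin] EF _ [s [sEV ->]].
elim: s sEV => [|p s IHs] sEV; first by rewrite big_nil.
have [/EF Fp Vp] := sEV p (mem_head p s).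
rewrite big_cons mulrC; apply: Flin => //.
by apply: IHs => q qs; apply: sEV; rewrite inE qs orbT.
Qed.

Lemma prodmodS E F V : submodule V V -> V 1 ->
  E `<=` F -> prodmod E V `<=` prodmod F V.
Proof.
move=> Vm V1 EF; apply: prodmod_min; first exact: prodmod_submodule.
exact: subset_trans EF (sub_prodmod V1).
Qed.

Lemma valuation_overringS R S V :
  R `<=` S -> valuation_overring S V -> valuation_overring R V.
Proof. by move=> RS [[Vr SV] Vv]; split=> //; split=> // x /RS/SV. Qed.

Lemma sub_b_op R E : E `<=` b_op R E.
Proof. by move=> x Ex V [/overring1 V1 _]; apply: sub_prodmod. Qed.

Lemma b_opS R S E F : R `<=` S -> E `<=` F -> b_op R E `<=` b_op S F.
Proof.
move=> RS EF x bx V vV; have [oV _] := vV.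
by apply: prodmodS EF _ (bx V (valuation_overringS RS vV));
  [apply: overring_submodule oV|apply: overring1 oV].
Qed.

Lemma b_op_idem R E : b_op R (b_op R E) `<=` b_op R E.
Proof.
move=> x bx V vV; have [/overring_submodule Vm _] := vV.
apply: (prodmod_min (prodmod_submodule E Vm)) (bx V vV).
by move=> y; apply.
Qed.

Lemma b_op_submodule R E : submodule R (b_op R E).
Proof.
have bm V : valuation_overring R V -> submodule R (prodmod E V).
  move=> [oV _]; have [_ RV] := oV; apply: submodule_subring RV _.
  exact: prodmod_submodule (overring_submodule oV).
split=> [V /bm[] //|a x y Ra bx b_y V vV].
by have [_ Elin] := bm V vV; apply: Elin Ra (bx V vV) (b_y V vV).
Qed.

(** * Ascent and descent of the b-Noetherian property *)

(** Multiplying by the valuation overrings of [R] already extends scalars to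
    [R], so an ideal of a smaller ring can be closed up in [R] directly, without
    first generating an ideal of [R] from it. *)
Lemma quasi_b_ideal_closure R I : submodule R R -> I `<=` R ->
  nonzero_set I -> quasi_b_ideal R (b_op R I `&` R).
Proof.
move=> Rm IR [x Ix x0]; split.
- by apply: submoduleI => //; apply: b_op_submodule.
- by move=> y [].
- by exists x => //; split; [apply: sub_b_op|apply: IR].
- apply/seteqP; split=> y [bJy Ry]; split=> //; last exact: sub_b_op.
  by apply: b_op_idem; apply: b_opS bJy => // z [].
Qed.

(** A fraction lies in an ideal of [S] exactly when its numerator does, since
    its denominator is a unit of [S]; so contraction to [R] loses nothing. *)
Lemma b_noetherian_localization R S :
  submodule R R -> R `<=` S ->
  (forall x, S x -> exists s, [/\ s != 0, R s, S s^-1 & R (s * x)]) ->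
  b_noetherian R -> b_noetherian S.
Proof.
move=> Rm RS Sfrac noethR I qI Imono.
have Im n : submodule S (I n) by case: (qI n).
have IS n : I n `<=` S by case: (qI n).
have qJ n : quasi_b_ideal R (I n `&` R).
  have [_ _ [x Ix x0] bI] := qI n; split.
  - by apply: submoduleI => //; apply: submodule_subring RS _.
  - by move=> y [].
  - have [s [s0 Rs _ Rsx]] := Sfrac _ (IS _ _ Ix).
    exists (s * x); last by rewrite mulf_neq0.
    by split=> //; apply: submoduleM (Im n) (RS _ Rs) Ix.
  - apply/seteqP; split=> y [Iy Ry]; split=> //; last exact: sub_b_op.
    rewrite -bI; split; last exact: RS.
    by apply: b_opS RS _ _ Iy => z [].
have [N HN] := noethR _ qJ (fun n => @setSI _ R _ _ (Imono n)).
have IJ m n x : I m `&` R `<=` I n `&` R -> I m x -> I n x.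
  move=> sub Ix; have [s [s0 Rs Ss Rsx]] := Sfrac _ (IS _ _ Ix).
  have [|Isx _] := sub (s * x).
    by split=> //; apply: submoduleM (Im m) (RS _ Rs) Ix.
  by rewrite -[x](mulKf s0); apply: submoduleM (Im n) Ss Isx.
exists N => n leNn; apply/seteqP; split=> x; apply: IJ.
  by rewrite HN.
by rewrite (HN n).
Qed.

(** Past the indices at which the finitely many chains of closures that are not
    eventually trivial become constant, every product [I n V] is constant, since
    each [V] contains some [T i]. *)
Lemma b_noetherian_finite_character
    (Idx : Type) (A : set Idx) (T : Idx -> set K) R :
  (forall i, A i -> submodule (T i) (T i)) ->
  (forall i, A i -> R `<=` T i) ->
  (forall V, valuation_overring R V ->
     exists2 i, A i & valuation_overring (T i) V) ->
  (forall x, R x -> x != 0 -> finite_set [set i | A i /\ ~ T i x^-1]) ->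
  (forall i, A i -> b_noetherian (T i)) ->
  b_noetherian R.
Proof.
move=> Tm RT cover finchar noethT I qI Imono.
have IR n : I n `<=` R by case: (qI n).
have Inz n : nonzero_set (I n) by case: (qI n).
have Ile m n : (m <= n)%N -> I m `<=` I n.
  move=> /subnK <-; elim: (n - m)%N => // k IHk.
  by rewrite addSn; apply: subset_trans IHk (Imono _).
have stab i : exists N, A i -> forall n, (N <= n)%N ->
    b_op (T i) (I n) `&` T i = b_op (T i) (I N) `&` T i.
  have [Ai|nAi] := pselect (A i); last by exists 0%N.
  have [n|n|N HN] := noethT i Ai (fun n => b_op (T i) (I n) `&` T i).
  - apply: quasi_b_ideal_closure (Tm i Ai) _ (Inz n).
    exact: subset_trans (IR n) (RT i Ai).
  - by apply: setSI; apply: b_opS (Imono n).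
  - by exists N.
have {stab}[N HN] := choice stab.
have [x I0x x0] := Inz 0%N.
have Rx := IR _ _ I0x.
have [s Bs] := (finite_seqP _).1 (finite_image N (finchar x Rx x0)).
set M := (\max_(m <- s) m)%N.
exists M => n leMn; apply/seteqP; split; last exact: Ile.
move=> a Ina; have Ra := IR _ _ Ina.
have [_ _ _ <-] := qI M; split=> // V vV.
have [i Ai vTV] := cover V vV; have [oV _] := vTV.
have V1 := overring1 oV; have Vm := overring_submodule oV.
have IVle m : (m <= M)%N -> prodmod (I m) V `<=` prodmod (I M) V.
  by move=> lemM; apply: prodmodS => //; apply: Ile.
have [Tx|nTx] := pselect (T i x^-1).
  (* Here [x] is a unit of [T i], so [I 0] already generates [V]. *)
  apply: (IVle 0%N) => //; have [_ TV] := oV.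
  rewrite -[a](divfK x0).
  apply: submoduleM (prodmod_submodule (I 0%N) Vm) _ (sub_prodmod V1 I0x).
  by apply: submoduleM Vm _ _; apply: TV => //; apply: RT Ra.
have leNM : (N i <= M)%N.
  apply: (@leq_bigmax_seq _ s xpredT id) => //.
  have : [set` s] (N i) by rewrite -Bs; exists i.
  by [].
apply: (IVle (N i) leNM).
have [bNa _] : (b_op (T i) (I (N i)) `&` T i) a.
  rewrite -(HN i Ai n (leq_trans leNM leMn)).
  by split; [apply: sub_b_op|apply: RT Ra].
exact: bNa.
Qed.

End BOperationTheory.

(** * Maximal ideals and localizations *)

Section Localizations.
Variable D : idomainType.
Implicit Types (P M J : {pred D}) (V : set {fraction D}).

Lemma idealr_closedM P a u : idealr_closed P -> u \in P -> a * u \in P.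
Proof. by case=> P0 _ Plin Pu; rewrite -[a * u]addr0; apply: Plin. Qed.

(** Zorn's lemma is applied to the sets whose union with [P] is a proper ideal
    rather than to the ideals above [P], because the empty chain has an empty
    union, which is not an ideal. *)
Lemma maximal_ideal_above P : idealr_closed P ->
  exists2 M, maximal_ideal M & {subset P <= M}.
Proof.
move=> idP.
pose Q (A : set D) := idealr_closed (mem (A `|` [set` P])).
have [|A [QA maxA]] := @Zorn_bigcup D Q.
  move=> F FQ Ftot; have [P0 P1 Plin] := idP; split.
  - by apply/mem_set; right.
  - apply/negP => /set_mem -[[X FX X1]|]; last by rewrite /= (negPf P1).
    by have [_ /negP[]] := FQ X FX; apply/mem_set; left.
  - have common u v : (\bigcup_(X in F) X `|` [set` P]) u ->
        (\bigcup_(X in F) X `|` [set` P]) v ->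
        u \in P /\ v \in P \/ exists X, [/\ F X, (X `|` [set` P]) u
          & (X `|` [set` P]) v].
      move=> [[X FX Xu]|Pu] [[Y FY Yv]|Pv]; last by left.
      + right; have [XY|YX] := Ftot X Y FX FY.
          by exists Y; split=> //; left=> //; apply: XY.
        by exists X; split=> //; left=> //; apply: YX.
      + by right; exists X; split=> //; [left|right].
      + by right; exists Y; split=> //; [right|left].
    move=> a u v /set_mem Fu /set_mem Fv; apply/mem_set.
    have [[Pu Pv]|[X [FX Xu Xv]]] := common u v Fu Fv.
      by right; apply: Plin.
    have [_ _ /(_ a u v (mem_set Xu) (mem_set Xv))/set_mem] := FQ X FX.
    by case=> [Xauv|]; [left; exists X|right].
exists (mem (A `|` [set` P]) : {pred D}); last first.
  by move=> x Px; rewrite inE; right.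
split=> // J idJ subJ x Jx; rewrite inE; left.
apply: contrapT => nAx; apply: (maxA [set` J]).
  split; first by move=> y Ay; apply: subJ; rewrite inE; left.
  by move=> /(_ x Jx).
have JPE : [set` J] `|` [set` P] = [set` J].
  by apply/setUidPl => y Py; apply: subJ; rewrite inE; right.
rewrite /Q JPE; have [J0 J1 Jlin] := idJ.
split; [by rewrite inE|by apply/negP; rewrite inE /= (negPf J1)|].
by move=> a u v /set_mem Ju /set_mem Jv; apply/mem_set; apply: Jlin.
Qed.

(** If [u] is not in [M], then [1 = a * u + m] with [m] in [M]; multiplying by
    [v] puts [v] in [M] as soon as [u * v] is. *)
Lemma maximal_ideal_prime M : maximal_ideal M -> prime_ideal M.
Proof.
move=> [idM maxM]; split=> // u v Muv; have [M0 M1 Mlin] := idM.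
apply/orP; have [Mu|nMu] := boolP (u \in M); [by left|right].
pose J := [set x | exists a m, m \in M /\ x = a * u + m].
have [[a [m [Mm one]]]|nJ1] := pselect (J 1).
  rewrite -[v]mul1r one mulrDl -mulrA; apply: Mlin => //.
  by rewrite mulrC; apply: idealr_closedM.
case/negP: nMu; apply: (maxM (mem J)).
- split; [|by apply/negP; rewrite inE|].
    by rewrite inE; exists 0, 0; rewrite mul0r addr0.
  move=> b x y /set_mem[a [m [Mm ->]]] /set_mem[a' [m' [Mm' ->]]].
  apply/mem_set; exists (b * a + a'), (b * m + m'); split; first exact: Mlin.
  by rewrite mulrDr mulrDl mulrA addrACA.
- by move=> m Mm; rewrite inE; exists 0, m; rewrite mul0r add0r.
- by rewrite inE; exists 1, 0; rewrite mul1r addr0.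
Qed.

Lemma notin_ideal_neq0 P s : idealr_closed P -> s \notin P -> s != 0.
Proof. by move=> [P0 _ _]; apply: contraNneq => ->. Qed.

Lemma dom_in_frac_submodule : submodule (dom_in_frac D) (dom_in_frac D).
Proof.
split=> [|_ _ _ [a _ <-] [x _ <-] [y _ <-]].
  by exists 0; rewrite ?tofrac0.
by exists (a * x + y) => //; rewrite tofracD tofracM.
Qed.

Lemma dom_sub_localization P :
  idealr_closed P -> dom_in_frac D `<=` localization P.
Proof. by move=> [_ P1 _] _ [a _ <-]; exists a, 1; rewrite tofrac1 divr1. Qed.

Lemma localization_submodule P :
  prime_ideal P -> submodule (localization P) (localization P).
Proof.
move=> [idP prP]; split.
  by apply: dom_sub_localization => //; exists 0; rewrite ?tofrac0.
move=> _ _ _ [a [s [nPs ->]]] [b [t [nPt ->]]] [c [r [nPr ->]]].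
have [s0 t0 r0] : [/\ tofrac s != 0, tofrac t != 0 & tofrac r != 0].
  by rewrite !tofrac_eq0; split; apply: (notin_ideal_neq0 idP).
exists (a * b * r + c * (s * t)), (s * t * r); split.
  by apply/negP => /prP/orP[/prP/orP[]|]; apply/negP.
by rewrite tofracD !tofracM mulf_div addf_div ?mulf_neq0.
Qed.

Lemma localizationV P s : s \notin P -> localization P (tofrac s)^-1.
Proof. by move=> nPs; exists 1, s; rewrite tofrac1 div1r. Qed.

Lemma localization_anti P M :
  {subset P <= M} -> localization M `<=` localization P.
Proof.
move=> PM _ [a [s [nMs ->]]]; exists a, s; split=> //.
by apply: contra nMs; apply: PM.
Qed.

Lemma b_noetherian_localization_prime P (R : set {fraction D}) :
  idealr_closed P -> submodule R R ->
  dom_in_frac D `<=` R -> R `<=` localization P ->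
  b_noetherian R -> b_noetherian (localization P).
Proof.
move=> idP Rm DR RP; apply: b_noetherian_localization => //.
move=> _ [a [s [nPs ->]]]; exists (tofrac s).
have s0 : tofrac s != 0 by rewrite tofrac_eq0 (notin_ideal_neq0 idP).
split=> //; [by apply: DR; exists s|exact: localizationV|].
by rewrite mulrC divfK //; apply: DR; exists a.
Qed.

(** [M] is chosen above the center of [V] on [D], the ideal of the elements of
    [D] that are not units of [V].  It is closed under sums because, of [x / y]
    and [y / x], one lies in [V]: if [x / y] does, then [x + y] is the multiple
    [(1 + x / y) * y] of the nonunit [y]. *)
Lemma valuation_overring_contains_localization V :
  valuation_overring (dom_in_frac D) V ->
  exists2 M, maximal_ideal M & valuation_overring (localization M) V.
Proof.
move=> [oV Vval]; have [Vr DV] := oV.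
have V1 := overring1 oV; have Vm := overring_submodule oV.
have Vd d : V (tofrac d) by apply: DV; exists d.
have VD x y : V x -> V y -> V (x + y).
  by move=> Vx Vy; have [_ /(_ 1 x y)] := Vm; rewrite mul1r; apply.
have VM x y : V x -> V y -> V (x * y) by apply: submoduleM Vm.
pose nonunit := [set x : {fraction D} | x = 0 \/ ~ V x^-1].
have nonunitM x y : V x -> nonunit y -> nonunit (x * y).
  move=> Vx ny; have [->|x0] := eqVneq x 0; first by left; rewrite mul0r.
  case: ny => [->|nVy]; first by left; rewrite mulr0.
  right=> Vxy; apply: nVy; rewrite -[y^-1](mulVKf x0) -invfM.
  exact: VM.
have nonunitD x y : nonunit x -> nonunit y -> nonunit (x + y).
  move=> nx ny; have [->|x0] := eqVneq x 0; first by rewrite add0r.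
  have [->|y0] := eqVneq y 0; first by rewrite addr0.
  wlog Vxy : x y nx ny x0 y0 / V (x / y).
    move=> wl; have [|Vxy|Vyx] := Vval (x / y).
      by rewrite mulf_neq0 ?invr_eq0.
      exact: wl.
    by rewrite addrC; apply: wl => //; rewrite -invf_div.
  have -> : x + y = (1 + x / y) * y by rewrite mulrDl mul1r divfK // addrC.
  by apply: nonunitM => //; apply: VD.
have idC : idealr_closed (mem [set d : D | nonunit (tofrac d)]).
  split.
  - by rewrite inE; left; rewrite tofrac0.
  - apply/negP; rewrite inE /= tofrac1 => -[/eqP|]; first by rewrite oner_eq0.
    by rewrite invr1.
  - move=> a u v /set_mem /= nu /set_mem /= nv; apply/mem_set => /=.
    by rewrite tofracD tofracM; apply: nonunitD => //; apply: nonunitM.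
have [M maxM CM] := maximal_ideal_above idC.
exists M => //; split=> //; split=> // _ [a [s [nMs ->]]]; apply: VM => //.
apply: contrapT => nVs; case/negP: nMs; apply: CM.
by rewrite inE; right.
Qed.

End Localizations.

Theorem corollary17 (D : idomainType) (hD : finite_character_max D) :
  (b_noetherian (dom_in_frac D) <->
     (forall P : {pred D}, prime_ideal P -> b_noetherian (localization P)))
  /\
  ((forall P : {pred D}, prime_ideal P -> b_noetherian (localization P)) <->
     (forall M : {pred D}, maximal_ideal M -> b_noetherian (localization M))).
Proof.
have global_prime : b_noetherian (dom_in_frac D) ->
    forall P : {pred D}, prime_ideal P -> b_noetherian (localization P).
  move=> noethD P [idP _]; apply: b_noetherian_localization_prime noethD => //.
    exact: dom_in_frac_submodule.
  exact: dom_sub_localization.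
have prime_max :
    (forall P : {pred D}, prime_ideal P -> b_noetherian (localization P)) ->
    forall M : {pred D}, maximal_ideal M -> b_noetherian (localization M).
  by move=> noethP M /maximal_ideal_prime; apply: noethP.
have max_prime :
    (forall M : {pred D}, maximal_ideal M -> b_noetherian (localization M)) ->
    forall P : {pred D}, prime_ideal P -> b_noetherian (localization P).
  move=> noethM P [idP _]; have [M maxM PM] := maximal_ideal_above idP.
  have [idM _] := maxM.
  apply: b_noetherian_localization_prime (noethM M maxM) => //.
  - exact: localization_submodule (maximal_ideal_prime maxM).
  - exact: dom_sub_localization.
  - exact: localization_anti.
have max_global :
    (forall M : {pred D}, maximal_ideal M -> b_noetherian (localization M)) ->
    b_noetherian (dom_in_frac D).
  apply: (@b_noetherian_finite_character _ _ (@maximal_ideal D)).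
  - by move=> M /maximal_ideal_prime; apply: localization_submodule.
  - by move=> M [idM _]; apply: dom_sub_localization.
  - exact: valuation_overring_contains_localization.
  - move=> _ [x _ <-]; rewrite tofrac_eq0 => x0.
    apply: sub_finite_set (hD x x0) => M [maxM nMx]; split=> //.
    by apply: contrapT => /negP /localizationV.
split; split=> //.
by move=> noethP; apply: max_global; apply: prime_max.
Qed.
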